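(* Let $r\ge 2$ and $2\le\ell_1\le\cdots\le\ell_r$ be integers. Then $$\mathrm{ex}\big(n,K^{(r)}_{\ell_1,\dots,\ell_r}\big)\le \frac{(\ell_r-1)^{1/(\ell_1\cdots\ell_{r-1})}}{r!}\; n^{r-1/(\ell_1\cdots\ell_{r-1})}\,(1+o(1))\qquad (n\to\infty).$$
   Context: $K^{(r)}_{\ell_1,\dots,\ell_r}$ is the complete $r$-partite $r$-uniform hypergraph with vertex set $V=V_1\cup\cdots\cup V_r$, where $V_1,\dots,V_r$ are pairwise disjoint with $|V_i|=\ell_i$, and with hyperedge set $\{\{x_1,\dots,x_r\}: x_i\in V_i,\ i=1,\dots,r\}$. An $r$-uniform hypergraph is $K^{(r)}_{\ell_1,\dots,\ell_r}$-free if it contains no copy of $K^{(r)}_{\ell_1,\dots,\ell_r}$ as a (not necessarily induced) sub-hypergraph. $\mathrm{ex}(n,K^{(r)}_{\ell_1,\dots,\ell_r})$ is the maximum number of hyperedges of a $K^{(r)}_{\ell_1,\dots,\ell_r}$-free $r$-uniform hypergraph on $n$ vertices. The $o(1)$ term tends to $0$ as $n\to\infty$ with $r,\ell_1,\dots,\ell_r$ fixed. *)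

(* Defs.v *)
(* MathComp and MathComp-Analysis *)
From mathcomp Require Import all_boot all_order all_algebra.
From mathcomp Require Import all_classical all_reals all_analysis.

Set Implicit Arguments.
Unset Strict Implicit.
Unset Printing Implicit Defensive.

(* A hypergraph on the vertex type V is given by its set of hyperedges. *)
Definition uniform_hypergraph (V : finType) (r : nat) (H : {set {set V}}) : bool :=
  [forall e in H, #|e| == r].

Definition contains_copy (W V : finType)
    (G : {set {set W}}) (H : {set {set V}}) : bool :=
  [exists f : {ffun W -> V},
    injectiveb f && [forall e in G, f @: e \in H]].

(* Vertices are the pairs (i, a) with a < l i, and V_i is the set of pairs with
   first component i.  A hyperedge is the range of a choice x of one vertex in
   each V_i. *)
Definition complete_partite (r : nat) (l : 'I_r -> nat) :
    {set {set {i : 'I_r & 'I_(l i)}}} :=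
  [set [set Tagged (fun i => 'I_(l i)) (x i) | i : 'I_r]
     | x : {dffun forall i : 'I_r, 'I_(l i)}].

(* Turan number of G among r-uniform hypergraphs.  The value is the junk 0 when
   no such hypergraph on n vertices is G-free, which requires G to have no
   hyperedges. *)
Definition turan_ex (W : finType) (r n : nat) (G : {set {set W}}) : nat :=
  \max_(H : {set {set 'I_n}} | uniform_hypergraph r H && ~~ contains_copy G H) #|H|.

(* Main.v *)
Require Import Defs.
From mathcomp Require Import all_boot all_order all_algebra.
From mathcomp Require Import ring lra.
From mathcomp Require Import all_classical all_reals all_analysis.
Set Implicit Arguments.
Unset Strict Implicit.
Unset Printing Implicit Defensive.

Import Order.TTheory GRing.Theory Num.Theory.
Import numFieldNormedType.Exports.
Local Open Scope ring_scope.

(** Let [H] be an [r]-uniform hypergraph on [n] vertices without a copy of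
    K(l_1, ..., l_r), put [t = l_r - 1] and [L = l_1 ... l_(r-1)].  The proof
    counts boxes: families (X_1, ..., X_r) of vertex sets with |X_i| = m_i all
    of whose transversals are hyperedges.  Divide the number of boxes of
    profile [m] by the product of the n^(m_i)/(m_i)! to get a density [p(m)].
    Two profiles are easy.  For m = (1, ..., 1) boxes are ordered hyperedges,
    so [p] is at least r! |H| / n^r ([card_boxes1]).  For m = (l_1, ..., l_r)
    the classes of a box are pairwise disjoint, so a box is a copy of
    K(l_1, ..., l_r) and [p = 0] ([boxes_copy]).

    The two are linked by enlarging one class at a time, from size 1 to size
    [s].  When the other classes are fixed, the sets admissible as class [k]
    are exactly the subsets of one set [link], so if [d] denotes the size of
    the link, the numbers of boxes before and after are the sums of [d] and of
    the binomials 'C(d, s).  Since s! 'C(d, s) is at least (d - s + 1)^s,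
    convexity of the power function gives ([box_density_step]):
    if [p(after) <= y ^ s] then [p(before) <= y + (s - 1) / n].
    Working with binomials rather than powers is what keeps the degenerate
    configurations, those with repeated vertices in a class, out of the count:
    they could be of the same order as the main term.

    Start from [p = 0] and undo the enlargements.  The first one, of the last
    class, gives the density t / n.  The one of class [k < r] takes an
    [l_k]-th root and adds (l_k - 1) / n.  Because l_k >= 2 and t >= 1,
    every such root is at least n^(-1/2), so the added term costs only a
    relative error of order n^(-1/2) ([density_bound]).  This ends with
      r! |H| / n^r <= (t/n)^(1/L) (1 + C / sqrt n),
    where C is the sum of the l_i - 1 over i < r: the error term is explicit
    and the inequality holds for every n > 0 ([turan_bound]). *)

(** * Convexity of powers and binomials *)

(** The power function lies above its tangent at [a]; multiplied out so that
    no division or subtraction occurs. *)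
Lemma young_tangent (R : realFieldType) (s : nat) (a x : R) :
  0 <= a -> 0 <= x ->
  s.+1%:R * (a ^+ s * x) <= x ^+ s.+1 + s%:R * a ^+ s.+1.
Proof.
move=> a0 x0; elim: s => [|s IHs].
  by rewrite expr0 !mul1r expr1 mul0r addr0.
have cross : a * x ^+ s.+1 + a ^+ s.+1 * x <= x ^+ s.+2 + a ^+ s.+2.
  rewrite -subr_ge0.
  have -> : x ^+ s.+2 + a ^+ s.+2 - (a * x ^+ s.+1 + a ^+ s.+1 * x)
          = (x ^+ s.+1 - a ^+ s.+1) * (x - a) by rewrite !exprS; ring.
  case: (lerP a x) => [ax|/ltW xa].
    by rewrite mulr_ge0 // subr_ge0 // lerXn2r.
  by rewrite mulr_le0 // subr_le0 // lerXn2r.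
have := lerD (ler_wpM2l a0 IHs) cross.
rewrite -!natr1 !exprS => H; lra.
Qed.

(** Jensen's inequality for the power function, with the number of terms
    replaced by any upper bound [M].  The constant part of the tangent at
    [a = S / M] is nonpositive, so counting it [M] times instead of once per
    term only weakens the lower bound. *)
Lemma sum_expn_ge (R : realFieldType) (J : finType) (Q : {pred J})
    (x : J -> R) (s : nat) (M : R) :
  (0 < s)%N -> 0 < M -> #|Q|%:R <= M -> (forall j, 0 <= x j) ->
  M * ((\sum_(j in Q) x j) / M) ^+ s <= \sum_(j in Q) x j ^+ s.
Proof.
case: s => // s _ M0 QM x0; set S := \sum_(j in Q) x j; set a := S / M.
have S0 : 0 <= S by apply: sumr_ge0.
have a0 : 0 <= a by rewrite divr_ge0 // ltW.
have : \sum_(j in Q) (s.+1%:R * (a ^+ s * x j))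
    <= \sum_(j in Q) (x j ^+ s.+1 + s%:R * a ^+ s.+1).
  by apply: ler_sum => j _; apply: young_tangent.
rewrite big_split /= sumr_const -!mulr_sumr -/S.
have SE : S = M * a by rewrite /a mulrC divfK // gt_eqF.
have : (s%:R * a ^+ s.+1) *+ #|Q| <= M * (s%:R * a ^+ s.+1).
  by rewrite -mulr_natl ler_wpM2r // mulr_ge0 // exprn_ge0.
have -> : s.+1%:R * (a ^+ s * S) = M * a ^+ s.+1 + M * (s%:R * a ^+ s.+1).
  by rewrite SE -natr1 exprS; ring.
move=> *; lra.
Qed.

Lemma expn_le_ffact (d s : nat) : ((d - s.-1) ^ s <= d ^_ s)%N.
Proof.
case: s => // s /=.
have [sd|ds] := leqP s d; last first.
  by rewrite (eqP (ltnW ds : (d - s == 0)%N)) exp0n.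
elim: s d sd => [|s IHs] d; first by rewrite subn0 expn1 ffactn1.
case: d => // d sd; rewrite subSS ffactSS expnS leq_mul ?IHs //.
by rewrite (leq_trans (leq_subr _ _)).
Qed.

Lemma ffact_le_expn (n k : nat) : (n ^_ k <= n ^ k)%N.
Proof.
elim: k n => [|k IHk] n; first by rewrite ffactn0.
by rewrite ffactnSr mulnC expnS leq_mul ?leq_subr.
Qed.

(** Since [s! 'C(d, s)] dominates [(d - (s - 1)) ^ s], Jensen's inequality
    bounds the average of [d - (s - 1)] by [y]; the shift [s - 1] is then added
    back. *)
Lemma bin_sum_bound (R : realFieldType) (J : finType) (Q : {pred J})
    (d : J -> nat) (s : nat) (M y : R) :
  (0 < s)%N -> 0 < M -> #|Q|%:R <= M -> 0 <= y ->
  (\sum_(j in Q) 'C(d j, s))%N%:R <= M * y ^+ s / s`!%:R ->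
  (\sum_(j in Q) d j)%N%:R <= M * (y + s.-1%:R).
Proof.
move=> s0 M0 QM y0 binM.
pose S : R := \sum_(j in Q) (d j - s.-1)%N%:R.
have powS : M * (S / M) ^+ s <= M * y ^+ s.
  apply: le_trans (sum_expn_ge s0 M0 QM _) _ => //.
  have fact0 : 0 < s`!%:R :> R by rewrite ltr0n fact_gt0.
  move: binM; rewrite ler_pdivlMr //; apply: le_trans.
  rewrite natr_sum mulr_suml; apply: ler_sum => j _.
  by rewrite -natrX -natrM ler_nat bin_ffact expn_le_ffact.
have SM : S <= M * y.
  have S0 : 0 <= S / M by rewrite divr_ge0 ?sumr_ge0 // ltW.
  move: powS; rewrite ler_pM2l // ler_pXn2r //.
  by rewrite ler_pdivrMr // mulrC.
rewrite natr_sum mulrDr.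
apply: le_trans (_ : S + \sum_(j in Q) s.-1%:R <= _).
  rewrite -big_split /=; apply: ler_sum => j _.
  by rewrite -natrD ler_nat addnC -leq_subLR.
by rewrite lerD // sumr_const -[leLHS]mulr_natl ler_wpM2r.
Qed.

(** * Boxes in a hypergraph *)

Definition complete_in (V : finType) (r : nat) (H : {set {set V}})
    (X : {ffun 'I_r -> {set V}}) : bool :=
  [forall x : {ffun 'I_r -> V},
    [forall i, x i \in X i] ==> ([set x i | i : 'I_r] \in H)].

Definition boxes (V : finType) (r : nat) (H : {set {set V}})
    (m : 'I_r -> nat) : {set {ffun 'I_r -> {set V}}} :=
  [set X : {ffun 'I_r -> {set V}} |
    [forall i, #|X i| == m i] & complete_in H X].

Definition upd (V : finType) (r : nat) (k : 'I_r) (S : {set V})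
    (X : {ffun 'I_r -> {set V}}) : {ffun 'I_r -> {set V}} :=
  [ffun i => if i == k then S else X i].

(** The classes of [Y] other than [k] determine which sets can fill class [k]:
    by [complete_upd] below, exactly the subsets of the link. *)
Definition link (V : finType) (r : nat) (H : {set {set V}}) (k : 'I_r)
    (Y : {ffun 'I_r -> {set V}}) : {set V} :=
  [set y | complete_in H (upd k [set y] Y)].

(** What remains of a box when class [k] is forgotten.  It is encoded as a
    family whose class [k] is empty, so that each box restricts to exactly one
    shell. *)
Definition shells (V : finType) (r : nat) (m : 'I_r -> nat) (k : 'I_r) :
    {set {ffun 'I_r -> {set V}}} :=
  [set Y : {ffun 'I_r -> {set V}} |
    [forall i, #|Y i| == (if i == k then 0 else m i)%N]].

(** A transversal meets class [k] in a single vertex, so completeness can be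
    tested one vertex of that class at a time. *)
Lemma complete_upd (V : finType) (r : nat) (H : {set {set V}}) (k : 'I_r)
    (S : {set V}) (Y : {ffun 'I_r -> {set V}}) :
  complete_in H (upd k S Y) = (S \subset link H k Y).
Proof.
apply/idP/fintype.subsetP => [/forallP HS y yS|SL].
  rewrite inE; apply/forallP => x; apply/implyP => /forallP xY.
  apply: (implyP (HS x)); apply/forallP => i; move: (xY i); rewrite !ffunE.
  by case: eqP => // _; rewrite inE => /eqP ->.
apply/forallP => x; apply/implyP => /forallP xY.
have xkS : x k \in S by move: (xY k); rewrite ffunE eqxx.
have := SL _ xkS; rewrite inE => /forallP/(_ x)/implyP; apply.
apply/forallP => i; move: (xY i); rewrite !ffunE.
by case: eqP => // -> _; rewrite inE.
Qed.

Lemma card_shells (V : finType) (r : nat) (m : 'I_r -> nat) (k : 'I_r) :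
  #|shells V m k| = (\prod_(i < r) 'C(#|V|, if i == k then 0 else m i))%N.
Proof.
pose F (i : 'I_r) : pred {set V} :=
  fun A => #|A| == (if i == k then 0%N else m i).
have shellsE : shells V m k =i pfamily (finset.set0 : {set V}) 'I_r F.
  move=> Y; rewrite inE.
  apply/forallP/pfamilyP => [FY|[_ FY] i]; last exact: FY.
  by split=> [|i _]; [apply/fintype.subsetP|exact: FY].
rewrite (fintype.eq_card shellsE) card_pfamily /image_mem.
rewrite foldrE big_map big_enum /=.
by apply: eq_bigr => i _; rewrite -card_draws cardsE.
Qed.

(** Boxes fibre over shells; by [complete_upd] the fibre over [Y] is the set of
    [m k]-element subsets of the link of [Y]. *)
Lemma card_boxes (V : finType) (r : nat) (H : {set {set V}})
    (m : 'I_r -> nat) (k : 'I_r) :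
  #|boxes H m| = (\sum_(Y in shells V m k) 'C(#|link H k Y|, m k))%N.
Proof.
rewrite -sum1_card (partition_big (upd k finset.set0) (mem (shells V m k))) /=;
  last first.
  move=> X; rewrite !inE => /andP[/forallP Xm _]; apply/forallP => i.
  by rewrite ffunE; case: (i =P k) => _; rewrite ?cards0 ?Xm.
apply: eq_bigr => Y; rewrite inE => /forallP Ym; rewrite sum1dep_card.
have Yk0 : Y k = finset.set0 by apply/eqP; rewrite -cards_eq0 (eqP (Ym k)) eqxx.
rewrite -cards_draws -(card_in_imset (f := fun S => upd k S Y)); last first.
  by move=> S T _ _ /ffunP/(_ k); rewrite !ffunE eqxx.
apply: fintype.eq_card => X; rewrite !inE; apply/idP/imsetP.
  move=> /andP[/andP[/forallP Xm HX] /eqP XY].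
  have EX : X = upd k (X k) Y.
    by apply/ffunP => i; rewrite -XY !ffunE; case: eqP => // ->.
  exists (X k) => //; rewrite inE -complete_upd -EX HX /=; exact: Xm.
move=> [S]; rewrite inE => /andP[SL /eqP Sm] ->.
rewrite complete_upd SL andbT; apply/andP; split.
  apply/forallP => i; rewrite ffunE; case: (i =P k) => [->|/eqP ik].
    by rewrite Sm.
  by have := Ym i; rewrite (negbTE ik).
apply/eqP/ffunP => i; rewrite !ffunE; case: eqP => // ->; exact/esym.
Qed.

(** The leading term of the product of the binomials 'C(n, m i), used as the
    normalisation since it is multiplicative in each class. *)
Definition box_weight (R : realFieldType) (r : nat) (n : nat)
    (m : 'I_r -> nat) : R :=
  \prod_(i < r) (n%:R ^+ m i / (m i)`!%:R).

Lemma card_shells_le (R : realFieldType) (V : finType) (r : nat)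
    (m : 'I_r -> nat) (k : 'I_r) :
  #|shells V m k|%:R <=
    box_weight R #|V| (fun i => if i == k then 0%N else m i).
Proof.
rewrite card_shells natr_prod; apply: ler_prod => i _.
rewrite ler0n /= ler_pdivlMr ?ltr0n ?fact_gt0 // -natrM -natrX ler_nat.
by rewrite bin_ffact ffact_le_expn.
Qed.

Definition box_density (R : realFieldType) (V : finType) (r : nat)
    (H : {set {set V}}) (m : 'I_r -> nat) : R :=
  #|boxes H m|%:R / box_weight R #|V| m.

(** The single enlargement step.  The sum of the link sizes over the shells
    counts the boxes of profile [m], the sum of their binomials those of
    profile [m'], and the shells are the same for both; [bin_sum_bound] applies
    with [n * y] in place of [y]. *)
Lemma box_density_step (R : realFieldType) (V : finType) (r : nat)
    (H : {set {set V}}) (m m' : 'I_r -> nat) (k : 'I_r) (y : R) :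
  (0 < #|V|)%N -> m k = 1%N -> (0 < m' k)%N ->
  (forall i, i != k -> m i = m' i) -> 0 <= y ->
  box_density R H m' <= y ^+ m' k ->
  box_density R H m <= y + (m' k).-1%:R / #|V|%:R.
Proof.
move=> V0 mk1 mk0 mm y0.
have n0 : 0 < #|V|%:R :> R by rewrite ltr0n.
set n : R := #|V|%:R in n0 *.
pose shell i := if i == k then 0%N else m i.
pose M := box_weight R #|V| shell.
have weight_gt0 (p : 'I_r -> nat) : 0 < box_weight R #|V| p.
  by apply: prodr_gt0 => i _; rewrite divr_gt0 ?exprn_gt0 // ltr0n fact_gt0.
have weightE (p : 'I_r -> nat) : (forall i, i != k -> p i = m i) ->
    box_weight R #|V| p = n ^+ p k / (p k)`!%:R * M.
  move=> pm; rewrite /M /box_weight (bigD1 k) //= [in RHS](bigD1 k) //=.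
  rewrite /shell eqxx fact0 expr0 divr1 mul1r; congr (_ * _).
  by apply: eq_bigr => i ik; rewrite (negbTE ik) pm.
have shellsE : shells V m' k = shells V m k.
  apply/finset.setP => Y; rewrite !inE; apply: eq_forallb => i.
  by case: (boolP (i == k)) => // /mm ->.
rewrite /box_density ler_pdivrMr // => bound.
rewrite ler_pdivrMr // (weightE m) // mk1 expr1 [1`!%N]/= divr1.
have -> : (y + (m' k).-1%:R / n) * (n * M) = M * (n * y + (m' k).-1%:R).
  by field; rewrite gt_eqF.
rewrite (card_boxes H m k) mk1 (eq_bigr _ (fun Y _ => bin1 _)).
apply: (bin_sum_bound (s := m' k)) => //.
- exact: weight_gt0.
- exact: card_shells_le.
- by rewrite mulr_ge0 // ltW.
rewrite -shellsE -card_boxes; apply: le_trans bound _.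
rewrite (weightE m'); last by move=> i /mm ->.
by rewrite exprMn le_eqVlt; apply/orP; left; apply/eqP; ring.
Qed.

Lemma imset_full_inj (V : finType) (r : nat) (x : {ffun 'I_r -> V}) :
  #|[set x i | i : 'I_r]| = r -> injective x.
Proof.
move=> cx i j xij.
have /imset_injP xinj : #|[set x i | i : 'I_r]| == #|'I_r|
  by rewrite cx card_ord.
exact: xinj.
Qed.

(** In a box with nonempty classes every transversal is an edge with [r]
    vertices.  Two classes sharing a vertex [u] would have a transversal using
    [u] twice, which is too small; hence the classes are disjoint and
    enumerating them embeds the complete [r]-partite hypergraph. *)
Lemma boxes_copy (V : finType) (r : nat) (H : {set {set V}})
    (l : 'I_r -> nat) :
  uniform_hypergraph r H -> (forall i, 0 < l i)%N ->
  ~~ contains_copy (complete_partite l) H -> boxes H l = finset.set0.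
Proof.
move=> unifH l0; apply: contraNeq => /finset.set0Pn[X]; rewrite inE.
move=> /andP[/forallP Xl /forallP HX].
have XlE i : l i = #|X i| by rewrite (eqP (Xl i)).
have transversal_inj (x : {ffun 'I_r -> V}) :
    (forall i, x i \in X i) -> injective x.
  move=> xX; have xH : [set x i | i : 'I_r] \in H.
    by apply: (implyP (HX x)); apply/forallP.
  have /forall_inP/(_ _ xH)/eqP cx := unifH.
  by apply: imset_full_inj; rewrite cx.
have [v vX] : exists v : {ffun 'I_r -> V}, forall i, v i \in X i.
  have ex i : exists v, v \in X i by apply/card_gt0P; rewrite -XlE.
  by exists [ffun i => xchoose (ex i)] => i; rewrite ffunE; apply: xchooseP.
have disjX i j u : u \in X i -> u \in X j -> i = j.
  move=> ui uj; apply/eqP; apply/negPn/negP => ij.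
  (* Alter a transversal so that it passes through u in both classes. *)
  pose x := [ffun h => if (h == i) || (h == j) then u else v h].
  have xX h : x h \in X h.
    by rewrite ffunE; case: (h =P i) => [->//|_]; case: (h =P j) => [->//|_ /=].
  have /transversal_inj/(_ i j) : forall h, x h \in X h by [].
  rewrite !ffunE !eqxx orbT => /(_ erefl) E.
  by rewrite E eqxx in ij.
pose g (w : {i : 'I_r & 'I_(l i)}) : V :=
  enum_val (cast_ord (XlE (tag w)) (tagged w)).
have gX w : g w \in X (tag w) by apply: enum_valP.
apply/existsP; exists [ffun w => g w]; apply/andP; split.
  apply/injectiveP => -[i a] [j b]; rewrite !ffunE => gE.
  have ia := gX (Tagged (fun i => 'I_(l i)) a).
  have jb := gX (Tagged (fun i => 'I_(l i)) b).
  have ij : i = j by rewrite gE in ia; apply: disjX ia jb.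
  (* The equality of dependent pairs reduces to one index type. *)
  move: gE {ia jb}; case: _ / ij b => b /enum_val_inj/cast_ord_inj /= -> //.
apply/forall_inP => e /imsetP[x _ ->].
pose z := [ffun i => g (Tagged (fun i => 'I_(l i)) (x i))].
have -> : [ffun w => g w] @: [set Tagged (fun i => 'I_(l i)) (x i) | i : 'I_r]
   = [set z i | i : 'I_r].
  by rewrite -imset_comp; apply: eq_imset => i; rewrite /= !ffunE.
by apply: (implyP (HX z)); apply/forallP => i; rewrite ffunE; apply: gX.
Qed.

(** An edge with [r] vertices has r! orderings, each a box of singletons. *)
Lemma card_boxes1 (V : finType) (r : nat) (H : {set {set V}}) :
  uniform_hypergraph r H ->
  (#|H| * r`! <= #|boxes H (fun _ : 'I_r => 1%N)|)%N.
Proof.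
move=> unifH.
pose orderings : {set {ffun 'I_r -> V}} :=
    [set x : {ffun 'I_r -> V} | [set x i | i : 'I_r] \in H].
have ordE : #|orderings| = (\sum_(e in H) r`!)%N.
  rewrite -sum1_card
    (partition_big (fun x : {ffun 'I_r -> V} => [set x i | i : 'I_r]) (mem H));
    last by move=> x; rewrite inE.
  apply: eq_bigr => e eH; rewrite sum1dep_card.
  have /forall_inP/(_ _ eH)/eqP ce := unifH.
  have -> : r`! = #|e| ^_ #|'I_r| by rewrite card_ord ce ffactnn.
  rewrite -card_inj_ffuns_on; apply: fintype.eq_card => x; rewrite !inE.
  apply/andP/andP => [[_ /eqP xe]|[/ffun_onP xe /injectiveP xinj]].
    split; first by apply/ffun_onP => i; rewrite -xe imset_f.
    by apply/injectiveP/imset_full_inj; rewrite xe.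
  have E : [set x i | i : 'I_r] = e.
    apply/eqP; rewrite eqEcard card_imset // card_ord ce leqnn andbT.
    by apply/fintype.subsetP => _ /imsetP[i _ ->].
  by rewrite E; split; [exact: eH|exact: eqxx].
rewrite -sum_nat_const -ordE.
pose single (x : {ffun 'I_r -> V}) := [ffun i => [set x i]].
have single_inj : injective single.
  move=> x y /ffunP E; apply/ffunP => i.
  by have := E i; rewrite !ffunE => /set1_inj.
rewrite -(card_imset _ single_inj).
apply/subset_leq_card/fintype.subsetP => X /imsetP[x].
rewrite inE => xH ->; rewrite inE; apply/andP; split.
  by apply/forallP => i; rewrite ffunE cards1.
apply/forallP => z; apply/implyP => /forallP zx.
suff -> : z = x by [].
by apply/ffunP => i; have := zx i; rewrite ffunE inE => /eqP.
Qed.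

(** * Undoing the enlargements *)

Definition partial_profile (r : nat) (l : nat -> nat) (k : nat) : 'I_r -> nat :=
  fun i => if (i < k)%N then l i.+1 else 1%N.
Arguments partial_profile : clear implicits.

(** Both inequalities that drive the descent, with [v = 1 / n] and
    [w = t / n].  The first says that the claimed bound after the step
    survives an [s]-th root, as [1 + x <= (1 + x) ^ s].  The second absorbs the
    additive loss into the relative error: as [s * p >= 2] and [v] is at most
    [1] and [w], the power of [w] dominates [sqrt v], and [v] is the square of
    [sqrt v]. *)
Lemma power_step (R : realType) (w v C : R) (s p : nat) :
  (1 < s)%N -> (0 < p)%N -> 0 < v <= 1 -> v <= w -> 0 <= C ->
  w `^ (1 / p%:R) * (1 + C * Num.sqrt v) <=
    (w `^ (1 / (s * p)%N%:R) * (1 + C * Num.sqrt v)) ^+ s /\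
  s.-1%:R * v <= w `^ (1 / (s * p)%N%:R) * (s.-1%:R * Num.sqrt v).
Proof.
move=> s1 p0 /andP[v0 v1] vw C0.
have s0 : (0 < s)%N by apply: ltnW.
have w0 : 0 < w := lt_le_trans v0 vw.
have sp0 : 0 < (s * p)%N%:R :> R by rewrite ltr0n muln_gt0 s0.
have base1 : 1 <= 1 + C * Num.sqrt v by rewrite lerDl mulr_ge0 // sqrtr_ge0.
split.
  rewrite exprMn -powR_mulrn ?powR_ge0 // -powRrM.
  have -> : 1 / (s * p)%N%:R * s%:R = 1 / p%:R :> R.
    by rewrite natrM; field; rewrite !pnatr_eq0 -!lt0n s0 p0.
  by rewrite ler_wpM2l ?powR_ge0 // ler_eXnr.
rewrite mulrCA ler_wpM2l //.
have sqrt_le : Num.sqrt v <= w `^ (1 / (s * p)%N%:R).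
  apply: (@le_trans _ _ (v `^ (1 / (s * p)%N%:R))); last first.
    by rewrite ge0_ler_powR ?nnegrE ?divr_ge0 ?(ltW v0) ?(ltW w0).
  rewrite -(powR12_sqrt (ltW v0)) -ler_ln ?posrE ?powR_gt0 // !ln_powR.
  apply: ler_wnM2r; first exact: ln_le0.
  rewrite div1r lef_pV2 ?posrE // ler_nat.
  by rewrite (leq_trans s1) // leq_pmulr.
rewrite -{1}(sqr_sqrtr (ltW v0)) expr2.
by rewrite ler_wpM2r // sqrtr_ge0.
Qed.

(** Descending induction on the number [k] of classes already enlarged, from
    [k = r - 1]; that starting case is the step from the empty set of boxes
    of full profile, taken with [y = 0]. *)
Lemma density_bound (R : realType) (V : finType) (r : nat) (l : nat -> nat)
    (H : {set {set V}}) (k : nat) :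
  (forall i, (1 <= i)%N -> (i <= r)%N -> (2 <= l i)%N) ->
  (0 < #|V|)%N -> uniform_hypergraph r H ->
  (k < r)%N ->
  ~~ contains_copy (complete_partite (fun i : 'I_r => l i.+1)) H ->
  box_density R H (partial_profile r l k) <=
    ((l r).-1%:R / #|V|%:R) `^ (1 / (\prod_(k.+1 <= i < r) l i)%N%:R)
    * (1 + (\sum_(k.+1 <= i < r) (l i).-1)%N%:R * Num.sqrt #|V|%:R^-1).
Proof.
move=> l2 V0 unifH kr freeH.
set v : R := #|V|%:R^-1; set w : R := (l r).-1%:R / _.
have v01 : 0 < v <= 1.
  by rewrite invr_gt0 ltr0n V0 invf_le1 ?ltr0n // ler1n.
(* Ordinals start at 0, so class j has target size l j.+1. *)
have step (j : nat) (y : R) : (j < r)%N -> 0 <= y ->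
    box_density R H (partial_profile r l j.+1) <= y ^+ l j.+1 ->
    box_density R H (partial_profile r l j) <= y + (l j.+1).-1%:R * v.
  move=> jr y0 yb; pose o := Ordinal jr.
  have oE : partial_profile r l j.+1 o = l j.+1
    by rewrite /partial_profile /= leqnn.
  rewrite -oE; apply: box_density_step => //.
  - by rewrite /partial_profile /= ltnn.
  - by rewrite oE (leq_trans _ (l2 _ _ jr)).
  - move=> i io; rewrite /partial_profile ltnS [(i <= j)%N]leq_eqVlt.
    by case: (i =P j :> nat) => // ij; case/eqP: io; apply: val_inj.
  - by rewrite oE.
move dE : (r - k.+1)%N => d.
have {dE kr} rE : r = (k + d).+1 by rewrite -dE -addSn subnKC.
elim: d k rE => [|d IHd] k rE;
  have kr : (k < r)%N by rewrite rE ltnS leq_addr.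
  have full : boxes H (partial_profile r l k.+1) = finset.set0.
    have -> : partial_profile r l k.+1 = fun i => l i.+1.
      apply/funext => i; rewrite /partial_profile.
      by rewrite -[k.+1]addn0 addSn -rE ltn_ord.
    by apply: boxes_copy => // i; rewrite (leq_trans _ (l2 _ _ (ltn_ord i))).
  have lr : r = k.+1 by rewrite rE addn0.
  rewrite -lr in full *; rewrite !big_geq // mul0r addr0 mulr1 divr1.
  rewrite powRr1 ?divr_ge0 //.
  have := step k 0 kr (lexx _); rewrite add0r -lr; apply.
  by rewrite /box_density full cards0 mul0r exprn_ge0.
have k1r : (k.+1 < r)%N by rewrite rE addnS ltnS ltnS leq_addr.
rewrite !(big_ltn k1r).
have rE' : r = (k.+1 + d).+1 by rewrite addSn -addnS.
have := IHd k.+1 rE'.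
set p := (\prod_(_ <= i < r) l i)%N; set c := (\sum_(_ <= i < r) (l i).-1)%N.
move=> IH.
have s1 : (1 < l k.+1)%N by apply: l2.
have p0 : (0 < p)%N.
  rewrite /p big_seq; apply: prodn_cond_gt0 => i; rewrite mem_index_iota.
  by move=> /andP[ki /ltnW ir]; rewrite ltnW // l2 // (leq_trans _ ki).
have vw : v <= w.
  have lr2 : (1 < l r)%N by apply: l2 => //; apply: leq_trans kr.
  by rewrite /w ler_peMl ?(ltW (andP v01).1) // ler1n -ltnS prednK // ltnW.
have [le1 le2] := power_step s1 p0 v01 vw (ler0n R c).
set W := w `^ (1 / (l k.+1 * p)%N%:R) in le1 le2 *.
have y0 : 0 <= W * (1 + c%:R * Num.sqrt v).
  by rewrite mulr_ge0 ?powR_ge0 // addr_ge0 // mulr_ge0 // sqrtr_ge0.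
apply: le_trans (step k _ kr y0 (le_trans IH le1)) _.
by rewrite natrD; lra.
Qed.

Lemma turan_bound (R : realType) (r : nat) (l : nat -> nat) (n : nat) :
  (forall i, (1 <= i)%N -> (i <= r)%N -> (2 <= l i)%N) ->
  (2 <= r)%N -> (0 < n)%N ->
  (turan_ex r n (complete_partite (fun i : 'I_r => l i.+1)))%:R <=
    ((l r)%:R - 1) `^ (1 / (\prod_(1 <= i < r) l i)%N%:R) / (r`!)%:R
    * n%:R `^ (r%:R - 1 / (\prod_(1 <= i < r) l i)%N%:R)
    * (1 + (\sum_(1 <= i < r) (l i).-1)%N%:R * Num.sqrt n%:R^-1) :> R.
Proof.
move=> l2 r2 n0; set P : R := 1 / _; set e : R := 1 + _.
have r0 : (0 < r)%N by apply: ltnW.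
have e0 : 0 <= e by rewrite addr_ge0 // mulr_ge0 // sqrtr_ge0.
rewrite /turan_ex; apply: (big_ind (fun m => m%:R <= _ :> R)).
- by rewrite !mulr_ge0 ?powR_ge0 // invr_ge0.
- by move=> x y ? ?; rewrite /maxn; case: ifP.
move=> H /andP[unifH freeH].
have n0R : 0 < n%:R :> R by rewrite ltr0n.
have := @density_bound R _ r l H 0 l2 _ unifH r0 freeH.
rewrite card_ord -/P -/e => /(_ n0) dens.
have profile1 : partial_profile r l 0 = (fun=> 1%N).
  by apply/funext => i; rewrite /partial_profile.
have := dens; rewrite profile1 /box_density /box_weight card_ord.
rewrite (eq_bigr (fun=> n%:R)) => [|i _]; last by rewrite expr1 divr1.
rewrite prodr_const card_ord ler_pdivrMr ?exprn_gt0 //.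
have := card_boxes1 unifH; rewrite -(ler_nat R) natrM => ord /(le_trans ord).
have lr1 : (l r)%:R - 1 = (l r).-1%:R :> R.
  by rewrite -subn1 natrB // (leq_trans _ (l2 _ r0 (leqnn r))).
rewrite lr1 powRM ?invr_ge0 // -powR_inv1 ?(ltW n0R) // -powRrM mulN1r.
rewrite powRD ?powR_mulrn ?(ltW n0R) ?(gt_eqF n0R) ?implybT //.
rewrite -ler_pdivlMr ?ltr0n ?fact_gt0 // => /le_trans -> //.
by rewrite le_eqVlt; apply/orP; left; apply/eqP; ring.
Qed.

(** * The asymptotic form *)

Local Open Scope classical_set_scope.
Local Open Scope ring_scope.

Lemma cvg_sqrt_inv (R : realType) :
  (fun n : nat => Num.sqrt n%:R^-1 : R) @ \oo --> (0 : R).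
Proof.
rewrite -[X in _ --> X]sqrtr0.
apply: continuous_cvg; first exact: sqrt_continuous.
by rewrite -cvg_shiftS; apply: cvg_harmonic.
Qed.

(* The sizes are l 1, ..., l r; the other values of l are irrelevant. *)
Theorem theorem4 (R : realType) (r : nat) (l : nat -> nat)
    (hr : (2 <= r)%N) (hl1 : (2 <= l 1)%N)
    (hl : forall i : nat, (1 <= i)%N -> (i < r)%N -> (l i <= l i.+1)%N) :
  exists o : nat -> R,
    o @ \oo --> (0 : R) /\
    forall n : nat,
      (turan_ex r n (complete_partite (fun i : 'I_r => l i.+1)))%:R <=
        ((l r)%:R - 1) `^ (1 / (\prod_(1 <= i < r) l i)%N%:R) / (r`!)%:R
        * n%:R `^ (r%:R - 1 / (\prod_(1 <= i < r) l i)%N%:R) * (1 + o n).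
Proof.
have l2 i : (1 <= i)%N -> (i <= r)%N -> (2 <= l i)%N.
  elim: i => // -[|i] IHi // _ ir.
  exact: leq_trans (IHi isT (ltnW ir)) (hl i.+1 isT ir).
exists (fun n => (\sum_(1 <= i < r) (l i).-1)%N%:R * Num.sqrt n%:R^-1); split.
  by rewrite -[X in _ --> X](mulr0 (\sum_(1 <= i < r) (l i).-1)%N%:R);
    apply: cvgMr; apply: cvg_sqrt_inv.
case=> [|n]; last exact: turan_bound.
(* Without vertices there is no edge of size r > 0, so the left side is 0. *)
suff -> : turan_ex r 0 (complete_partite (fun i : 'I_r => l i.+1)) = 0%N.
  rewrite invr0 sqrtr0 mulr0 addr0 mulr1.
  by rewrite mulr_ge0 ?powR_ge0 // divr_ge0 ?powR_ge0.
rewrite /turan_ex big1 // => H /andP[/forall_inP unifH _].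
apply/eqP; rewrite cards_eq0 -finset.subset0; apply/fintype.subsetP => e eH.
have := unifH e eH; have := max_card (mem e).
rewrite card_ord leqn0 => /eqP -> /eqP r0.
by rewrite -r0 in hr.
Qed.
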